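(* Let $w_1,w_2,w_3$ be any odd positive integers, let $n\ge 0$ be an integer and let $y_1\in\mathbb{Z}_p$. Then \begin{align*} &(w_1w_2)^{n}\sum_{i=0}^{w_1-1}\sum_{j=0}^{w_2-1}(-1)^{i+j}q^{w_3(w_2i+w_1j)}E_{n,q^{w_1w_2}}\Big(w_3y_1+\frac{w_3}{w_1}i+\frac{w_3}{w_2}j\Big)\\ =&(w_2w_3)^{n}\sum_{i=0}^{w_2-1}\sum_{j=0}^{w_3-1}(-1)^{i+j}q^{w_1(w_3i+w_2j)}E_{n,q^{w_2w_3}}\Big(w_1y_1+\frac{w_1}{w_2}i+\frac{w_1}{w_3}j\Big)\\ =&(w_3w_1)^{n}\sum_{i=0}^{w_3-1}\sum_{j=0}^{w_1-1}(-1)^{i+j}q^{w_2(w_1i+w_3j)}E_{n,q^{w_1w_3}}\Big(w_2y_1+\frac{w_2}{w_3}i+\frac{w_2}{w_1}j\Big). \end{align*}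
   Context: Let $p$ be a fixed odd prime, $\mathbb{C}_p$ the completion of an algebraic closure of $\mathbb{Q}_p$ with absolute value normalized by $|p|_p=1/p$, and let $q\in\mathbb{C}_p$ be fixed with $|q-1|_p<p^{-1/(p-1)}$. For $r\in\mathbb{C}_p$ with $|r-1|_p<p^{-1/(p-1)}$ (in particular for $r=q^w$, $w$ a positive integer), the $r$-Euler polynomials $E_{n,r}(x)$ ($n\ge 0$) are the polynomials in $x$ defined by the generating function $$\frac{2}{re^{t}+1}e^{xt}=\sum_{n=0}^{\infty}E_{n,r}(x)\frac{t^n}{n!}.$$ *)

(* Defs.v *)
From HB Require Import structures.
From mathcomp Require Import all_boot all_order all_algebra.
From mathcomp Require Import reals exp.

Set Implicit Arguments.
Unset Strict Implicit.
Unset Printing Implicit Defensive.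

Import Order.TTheory GRing.Theory Num.Theory.
Local Open Scope ring_scope.

Record is_absval (R : realType) (K : fieldType) (abs : K -> R) : Prop :=
  IsAbsval {
    absval_ge0 : forall x, 0 <= abs x;
    absval_eq0 : forall x, (abs x == 0) = (x == 0);
    absvalM : forall x y, abs (x * y) = abs x * abs y;
    absval_ultra : forall x y, abs (x + y) <= Num.max (abs x) (abs y)
  }.

Definition absval_cauchy (R : realType) (K : fieldType) (abs : K -> R)
    (u : nat -> K) : Prop :=
  forall e : R, 0 < e ->
    exists N, forall m n, (N <= m)%N -> (N <= n)%N -> abs (u m - u n) < e.

Definition absval_cvg (R : realType) (K : fieldType) (abs : K -> R)
    (u : nat -> K) (l : K) : Prop :=
  forall e : R, 0 < e -> exists N, forall n, (N <= n)%N -> abs (u n - l) < e.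

Definition absval_complete (R : realType) (K : fieldType) (abs : K -> R) :
    Prop :=
  forall u, absval_cauchy abs u -> exists l, absval_cvg abs u l.

Record is_completion (R : realType) (K L : fieldType)
    (absK : K -> R) (absL : L -> R) (f : {rmorphism K -> L}) : Prop :=
  IsCompletion {
    completion_absval : is_absval absL;
    completion_isometry : forall x, absL (f x) = absK x;
    completion_dense :
      forall (y : L) (e : R), 0 < e -> exists x : K, absL (y - f x) < e;
    completion_complete : absval_complete absL
  }.

Definition is_alg_closure (K L : fieldType) (f : {rmorphism K -> L}) : Prop :=
  GRing.closed_field_axiom L /\ forall y : L, algebraicOver f y.

Definition padic_abs (R : realType) (p : nat) (x : rat) : R :=
  if x == 0 then 0
  else p%:R ^+ logn p `|denq x|%N / p%:R ^+ logn p `|numq x|%N.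

(* Q -> Q_p -> an algebraic closure of Q_p -> C_p. The absolute value of the
   algebraic closure is the (unique) extension of the one of Q_p; the
   normalization |p| = 1/p comes from padic_abs. *)
Record Cp_tower (R : realType) (p : nat) := CpTower {
  Qp : fieldType;
  absQp : Qp -> R;
  rat_to_Qp : {rmorphism rat -> Qp};
  Qp_completion : is_completion (@padic_abs R p) absQp rat_to_Qp;
  Qpbar : fieldType;
  absQpbar : Qpbar -> R;
  Qp_to_Qpbar : {rmorphism Qp -> Qpbar};
  Qpbar_alg_closure : is_alg_closure Qp_to_Qpbar;
  Qpbar_absval : is_absval absQpbar;
  Qpbar_extends : forall x, absQpbar (Qp_to_Qpbar x) = absQp x;
  Cp : fieldType;
  absCp : Cp -> R;
  Qpbar_to_Cp : {rmorphism Qpbar -> Cp};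
  Cp_completion : is_completion absQpbar absCp Qpbar_to_Cp
}.

Arguments Qp {R p} T : rename.
Arguments absQp {R p} T x : rename.
Arguments rat_to_Qp {R p} T : rename.
Arguments Qpbar {R p} T : rename.
Arguments absQpbar {R p} T x : rename.
Arguments Qp_to_Qpbar {R p} T : rename.
Arguments Cp {R p} T : rename.
Arguments absCp {R p} T x : rename.
Arguments Qpbar_to_Cp {R p} T : rename.

Definition Qp_to_Cp (R : realType) (p : nat) (T : Cp_tower R p) (x : Qp T) :
    Cp T := Qpbar_to_Cp T (Qp_to_Qpbar T x).

Definition padic_int (R : realType) (p : nat) (T : Cp_tower R p) :
    pred (Qp T) := [pred x | absQp T x <= 1].

(* Formal power series in t over A, as sequences of coefficients. *)
Section FormalPowerSeries.
Variable A : comUnitRingType.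
Implicit Types a b : nat -> A.

Definition fps_const (c : A) : nat -> A := fun n => if n is 0 then c else 0.

Definition fps_add a b : nat -> A := fun n => a n + b n.

Definition fps_mul a b : nat -> A :=
  fun n => \sum_(i < n.+1) a i * b (n - i)%N.

(* The list of the coefficients 0..n of 1/a, from a * (1/a) = 1; meaningful
   when a 0 is a unit. *)
Fixpoint fps_inv_seq a (n : nat) : seq A :=
  if n is m.+1 then
    let s := fps_inv_seq a m in
    rcons s (- (a 0)^-1 * \sum_(i < m.+1) a i.+1 * s`_(m - i))
  else [:: (a 0)^-1].

Definition fps_inv a : nat -> A := fun n => (fps_inv_seq a n)`_n.

Definition fps_div a b : nat -> A := fps_mul a (fps_inv b).

(* e^{ct} *)
Definition fps_exp (c : A) : nat -> A := fun n => c ^+ n / n`!%:R.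

Lemma size_fps_inv_seq a n : size (fps_inv_seq a n) = n.+1.
Proof. by elim: n => //= n IH; rewrite size_rcons IH. Qed.

Lemma nth_fps_inv_seq a n k : (k <= n)%N -> (fps_inv_seq a n)`_k = fps_inv a k.
Proof.
elim: n => [|n IH]; first by rewrite leqn0 => /eqP ->.
rewrite leq_eqVlt => /predU1P[-> //|lt_kn].
by rewrite /= nth_rcons size_fps_inv_seq lt_kn IH.
Qed.

Lemma fps_mulV a : a 0 \is a GRing.unit ->
  fps_mul a (fps_inv a) =1 fps_const 1.
Proof.
move=> ua [|n]; rewrite /fps_mul.
  by rewrite big_ord_recl big_ord0 addr0 /fps_inv /= divrr.
rewrite big_ord_recl subn0 /= {1}/fps_inv /= nth_rcons size_fps_inv_seq ltnn.
rewrite eqxx mulrA mulrN divrr // mulN1r addrC; apply/eqP; rewrite subr_eq0.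
by apply/eqP/eq_bigr => i _; rewrite subSS nth_fps_inv_seq // leq_subr.
Qed.

End FormalPowerSeries.

(* E_{n,r}(x) in K[x]: n! times the coefficient of t^n in
   2 / (r e^t + 1) * e^{xt}, a formal power series over K[x]. *)
Definition qEuler (K : fieldType) (n : nat) (r : K) : {poly K} :=
  n`!%:R *
  fps_mul
    (fps_div (fps_const 2)
       (fps_add (fps_mul (fps_const r%:P) (fps_exp 1)) (fps_const 1)))
    (fps_exp 'X) n.

(* Main.v *)
Require Import Defs.
From mathcomp Require Import all_boot all_order all_algebra.
From mathcomp Require Import reals exp.
From mathcomp Require Import qpoly ring.

Import Order.TTheory GRing.Theory Num.Theory.
Local Open Scope ring_scope.

Set Implicit Arguments.
Unset Strict Implicit.
Unset Printing Implicit Defensive.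

(** Work with power series in [t] modulo [t^(n+1)] and put [u := q e^t].
    Substituting [t -> w1 w2 t] in the generating function of the Euler
    polynomials and summing the two geometric progressions, which have odd
    length and ratios [- u^(w2 w3)] and [- u^(w3 w1)], one finds that the first
    expression is [n!] times the coefficient of [t^n] in
    [2 e^(w1 w2 w3 y t) (1 + u^(w1 w2 w3))^2
       / ((1 + u^(w1 w2)) (1 + u^(w2 w3)) (1 + u^(w3 w1)))],
    which is symmetric in [w1, w2, w3]. The denominators are invertible because
    [q^k] is close to [1] and [2] is a [p]-adic unit. *)

(** Applied with [f] the evaluation at a point, it carries the inverse series over [K[x]] inside
    [qEuler] to an inverse series over [K]. *)
Lemma fps_inv_rmorph (A B : comUnitRingType) (f : {rmorphism A -> B})
    (a : nat -> A) :
  a 0 \is a GRing.unit -> fps_inv (f \o a) =1 f \o fps_inv a.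
Proof.
move=> ua n; have inv_seq m : fps_inv_seq (f \o a) m = map f (fps_inv_seq a m).
  elim: m => [|m IHm] /=; first by rewrite rmorphV.
  rewrite IHm map_rcons; congr rcons.
  rewrite rmorphM rmorphN rmorphV // rmorph_sum; congr (_ * _).
  apply: eq_bigr => i _; rewrite rmorphM (nth_map 0) //.
  by rewrite size_fps_inv_seq ltnS leq_subr.
by rewrite /fps_inv inv_seq (nth_map 0) // size_fps_inv_seq.
Qed.

(** * Euler polynomials evaluated at a point of the field *)

Section EulerEval.
Variable K : fieldType.
Hypothesis charK : [pchar K] =i pred0.

Lemma natr_fact_neq0 m : m`!%:R != 0 :> K.
Proof. by rewrite (proj1 (pcharf0P K) charK) -lt0n fact_gt0. Qed.

Lemma fps_mul_exp (a b : K) :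
  fps_mul (fps_exp a) (fps_exp b) =1 fps_exp (a + b).
Proof.
move=> m; rewrite /fps_mul /fps_exp addrC exprDn mulr_suml.
apply: eq_bigr => i _; have le_im : (i <= m)%N by rewrite -ltnS.
rewrite -mulr_natr -(bin_fact le_im) !natrM.
have := natr_fact_neq0 m; rewrite -(bin_fact le_im) !natrM !mulf_eq0 !negb_or.
by case/and3P=> nz1 nz2 nz3; field; rewrite nz1 nz2 nz3.
Qed.

Definition euler_denom (r : K) : nat -> K :=
  fps_add (fps_mul (fps_const r) (fps_exp 1)) (fps_const 1).

Lemma euler_denom0 (r : K) : euler_denom r 0 = r + 1.
Proof.
rewrite /euler_denom /fps_add /fps_mul big_ord1 /= /fps_exp expr0.
by rewrite divr1 mulr1.
Qed.

Lemma horner_qEuler m (r x : K) : r + 1 != 0 ->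
  (qEuler m r).[x] = m`!%:R *
    fps_mul (fps_div (fps_const 2) (euler_denom r)) (fps_exp x) m.
Proof.
move=> r1; pose f : {rmorphism {poly K} -> K} := horner_eval x.
have fE (P : {poly K}) : P.[x] = f P by [].
have fV k : f (k`!%:R^-1) = k`!%:R^-1.
  by rewrite -polyC_natr polyCV -fE hornerC.
have fX k : f (fps_exp 'X k) = fps_exp x k.
  by rewrite /fps_exp rmorphM fV rmorphXn -fE hornerX.
set d := fps_add (fps_mul (fps_const r%:P) (fps_exp 1)) (fps_const 1).
have fd : f \o d =1 euler_denom r.
  move=> k; rewrite /= /d /euler_denom /fps_add rmorphD; congr (_ + _).
    rewrite rmorph_sum; apply: eq_bigr => i _; rewrite rmorphM; congr (_ * _).
      by case: (i : nat) => [|j]; rewrite /= -fE ?hornerC ?horner0.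
    by rewrite /fps_exp rmorphM fV rmorphXn rmorph1.
  by case: k => [|k] /=; rewrite ?rmorph1 ?rmorph0.
have d0 : d 0 = (r + 1)%:P.
  rewrite /d /fps_add /fps_mul big_ord1 /= /fps_exp expr0 divr1 mulr1.
  by rewrite polyCD.
(* The constant term of the series is the nonzero constant polynomial [r + 1], a unit of [K[x]]. *)
have ud : d 0 \is a GRing.unit.
  by rewrite d0 poly_unitE size_polyC r1 coefC unitfE.
(* [fd] is only a pointwise equality, so it is carried through the recursion of [fps_inv_seq] by
   induction. *)
have eq_inv : fps_inv (f \o d) =1 fps_inv (euler_denom r).
  have eq_seq k : fps_inv_seq (f \o d) k = fps_inv_seq (euler_denom r) k.
    elim: k => [|k IHk]; first by rewrite /= -fd.
    rewrite /= IHk -fd; congr rcons; congr (_ * _).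
    by apply: eq_bigr => i _; rewrite -fd.
  by move=> k; rewrite /fps_inv eq_seq.
rewrite fE /qEuler -/d rmorphM rmorph_nat; congr (_ * _).
rewrite rmorph_sum; apply: eq_bigr => i _; rewrite rmorphM fX; congr (_ * _).
rewrite rmorph_sum; apply: eq_bigr => j _; rewrite rmorphM; congr (_ * _).
  by case: (j : nat) => [|k]; rewrite /= ?rmorph_nat ?rmorph0.
by rewrite -eq_inv fps_inv_rmorph.
Qed.

End EulerEval.

(** * Power series modulo [t^(N+1)] *)

Section TruncatedSeries.
Variables (K : fieldType) (N : nat).

(** This quotient is a commutative ring with units, in which [ring] and inverses are available. *)
Definition tser := {poly %/ ('X^(N.+1) : {poly K})}.

(* The series [a (c t)] modulo [t^(N+1)]. *)
Definition trunc (c : K) (a : nat -> K) : tser :=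
  in_qpoly 'X^(N.+1) (\poly_(i < N.+1) (c ^+ i * a i)).

(** Split [P] at degree [N+1]: the upper part is a multiple of [X^(N+1)], which is zero in the
    quotient. *)
Lemma coef_in_qpolyXn (P : {poly K}) k : (k <= N)%N ->
  (in_qpoly 'X^(N.+1) P : {poly K})`_k = P`_k.
Proof.
move=> le_kN; rewrite -[in LHS](poly_take_drop N.+1 P) in_qpolyD in_qpolyM.
have -> : in_qpoly 'X^(N.+1) 'X^(N.+1) = 0 :> tser.
  apply: val_inj.
  by rewrite /= mk_monic_Xn /= Pdiv.RingMonic.rmodpp // monicXn.
rewrite mulr0 addr0 in_qpoly_small; first by rewrite coef_take_poly ltnS le_kN.
by rewrite mk_monic_Xn size_polyXn ltnS size_take_poly.
Qed.

Lemma tserP (P Q : tser) :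
  (forall k, (k <= N)%N -> (P : {poly K})`_k = (Q : {poly K})`_k) -> P = Q.
Proof.
move=> eqPQ; apply/npolyP => k; have [/eqPQ //|lt_Nk] := leqP k N.
by rewrite !big_coef_npoly // mk_monic_Xn size_polyXn.
Qed.

Lemma coef_trunc c a k : (k <= N)%N ->
  (trunc c a : {poly K})`_k = c ^+ k * a k.
Proof. by move=> le_kN; rewrite coef_in_qpolyXn // coef_poly ltnS le_kN. Qed.

Lemma eq_trunc c a b : a =1 b -> trunc c a = trunc c b.
Proof.
by move=> eq_ab; apply: tserP => k le_kN; rewrite !coef_trunc // eq_ab.
Qed.

Lemma truncM c a b : trunc c (fps_mul a b) = trunc c a * trunc c b.
Proof.
apply: tserP => k le_kN; rewrite coef_trunc // -in_qpolyM coef_in_qpolyXn //.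
rewrite coefM mulr_sumr; apply: eq_bigr => i _.
have le_ik : (i <= k)%N by rewrite -ltnS.
rewrite !coef_poly !ltnS (leq_trans le_ik) // (leq_trans (leq_subr _ _)) //.
by rewrite mulrACA -exprD subnKC.
Qed.

Lemma truncD c a b : trunc c (fps_add a b) = trunc c a + trunc c b.
Proof. by apply: tserP => k le_kN; rewrite coefD !coef_trunc // mulrDr. Qed.

Lemma trunc_const c k : trunc c (fps_const k) = k%:A.
Proof.
apply: tserP => -[|j] le_jN;
  rewrite coef_trunc //= coefZ coefC ?mul1r ?mulr1 //.
by rewrite !mulr0.
Qed.

Definition texp (z : K) : tser := trunc 1 (fps_exp z).

Lemma trunc_exp c z : trunc c (fps_exp z) = texp (c * z).
Proof.
apply: tserP => k le_kN; rewrite !coef_trunc // expr1n mul1r /fps_exp exprMn.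
by rewrite mulrA.
Qed.

Hypothesis charK : [pchar K] =i pred0.

Lemma texpD a b : texp (a + b) = texp a * texp b.
Proof. by rewrite -truncM; apply/esym/eq_trunc/fps_mul_exp. Qed.

Lemma texp_natr a m : texp (a *+ m) = texp a ^+ m.
Proof.
elim: m => [|m IHm]; last by rewrite mulrS texpD IHm (exprS (texp a)).
rewrite mulr0n (expr0 (texp a)) -[1 in RHS](scale1r (1 : tser)) -(trunc_const 1).
apply: eq_trunc => -[|k].
  by rewrite /fps_exp expr0 divr1.
by rewrite /fps_exp expr0n mul0r.
Qed.

Lemma trunc_euler_denom c r : trunc c (euler_denom r) = 1 + r *: texp c.
Proof.
rewrite truncD truncM !trunc_const trunc_exp mulr1 -scalerAl mul1r scale1r.
by rewrite addrC.
Qed.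

Lemma trunc_inv c a : a 0 != 0 -> trunc c a * trunc c (fps_inv a) = 1.
Proof.
move=> a0; rewrite -truncM -[1 in RHS](scale1r (1 : tser)) -(trunc_const c).
by apply/eq_trunc/fps_mulV; rewrite unitfE.
Qed.

(** The truncation of the formal inverse is an inverse, because the constant term [r + 1] is
    nonzero. *)
Lemma euler_denom_unit c r : r + 1 != 0 ->
  1 + r *: texp c \is a (@GRing.unit tser).
Proof.
move=> r1; rewrite -trunc_euler_denom; apply/unitrPr.
exists (trunc c (fps_inv (euler_denom r))).
by rewrite trunc_inv // euler_denom0.
Qed.

(** This is the generating function after [t -> c t]; dividing by [m!] cancels the factorial in
    [qEuler]. *)
Lemma trunc_qEuler c r x : r + 1 != 0 ->
  trunc c (fun m => (qEuler m r).[x] / m`!%:R) =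
    2%:R%:A * texp (c * x) / (1 + r *: texp c).
Proof.
move=> r1.
have -> : trunc c (fun m => (qEuler m r).[x] / m`!%:R) =
    trunc c (fps_mul (fps_div (fps_const 2) (euler_denom r)) (fps_exp x)).
  apply: eq_trunc => m; rewrite horner_qEuler // mulrAC divff ?mul1r //.
  exact: natr_fact_neq0.
rewrite !truncM trunc_const trunc_exp.
have U := euler_denom_unit c r1.
apply: (mulIr U); rewrite divrK // -trunc_euler_denom.
rewrite mulrAC -[X in X * texp _]mulrA [X in _ * X * texp _]mulrC.
by rewrite trunc_inv ?mulr1 // euler_denom0.
Qed.

End TruncatedSeries.

(** An odd length gives [(- v)^w = - v^w], hence the numerator [1 + v^w]. *)
Lemma geom_sum_odd (A : comUnitRingType) (v : A) w :
  odd w -> 1 + v \is a GRing.unit ->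
  \sum_(i < w) (- v) ^+ i = (1 + v ^+ w) / (1 + v).
Proof.
move=> odd_w U; apply: (mulIr U); rewrite divrK //.
rewrite mulrC -[1 + v]opprK opprD -[- 1 - v]addrC mulNr -subrX1 opprB.
by rewrite exprNn -signr_odd odd_w expr1 mulN1r opprK.
Qed.

(** Regroups one term of the double sum: [a], [b] are powers of [q] and [v], [w] exponentials.
    Scalars pass through [in_alg] so that [ring] can work inside [A]. *)
Lemma scale_signed_terms (K : fieldType) (A : comAlgType K) (a b : K)
    (x d e v w : A) (i j : nat) :
  x * e * d * ((-1) ^+ i * (a *: v) * ((-1) ^+ j * (b *: w))) =
    ((-1) ^+ (i + j) * (a * b)) *: (x * (e * v * w) * d).
Proof.
rewrite -[a *: v]mulr_algl -[b *: w]mulr_algl -[RHS]mulr_algl.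
rewrite -!in_algE !rmorphM rmorphXn rmorphN1 exprD.
set a' := GRing.in_alg A a; set b' := GRing.in_alg A b; ring.
Qed.

(** The first of the three expressions; rotating [w1, w2, w3] produces the others. *)
Definition euler_double_sum (K : fieldType) (q y : K) (n w1 w2 w3 : nat) : K :=
  (w1 * w2)%:R ^+ n *
    \sum_(i < w1) \sum_(j < w2)
      (-1) ^+ (i + j) * q ^+ (w3 * (w2 * i + w1 * j)) *
      (qEuler n (q ^+ (w1 * w2))).[
        w3%:R * y + w3%:R / w1%:R * i%:R + w3%:R / w2%:R * j%:R].

(** * The symmetric series behind the double sums *)

Section Symmetry.
Variables (K : fieldType) (q y : K) (n : nat).
Hypothesis charK : [pchar K] =i pred0.
Hypothesis q_neqN1 : forall k, q ^+ k + 1 != 0.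

Let u : tser K n := q *: texp n 1.

Definition euler_sum_series (w1 w2 w3 : nat) : tser K n :=
  2%:R%:A * texp n ((w1 * w2 * w3)%:R * y) * (1 + u ^+ (w1 * w2 * w3)) ^+ 2 *
  ((1 + u ^+ (w1 * w2))^-1 * (1 + u ^+ (w2 * w3))^-1 * (1 + u ^+ (w3 * w1))^-1).

Lemma uX k : u ^+ k = q ^+ k *: texp n k%:R.
Proof. by rewrite exprZn -texp_natr. Qed.

Lemma unit_uX k : 1 + u ^+ k \is a GRing.unit.
Proof. by rewrite uX euler_denom_unit. Qed.

Lemma euler_double_sumE w1 w2 w3 : odd w1 -> odd w2 ->
  euler_double_sum q y n w1 w2 w3 =
    n`!%:R * (euler_sum_series w1 w2 w3 : {poly K})`_n.
Proof.
move=> odd1 odd2.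
(* Oddness also excludes [w = 0], so [w] is invertible in characteristic 0. *)
have nz w : odd w -> w%:R != 0 :> K.
  by rewrite (proj1 (pcharf0P K) charK); case: w.
pose x i j : K := w3%:R * y + w3%:R / w1%:R * i%:R + w3%:R / w2%:R * j%:R.
have -> : euler_sum_series w1 w2 w3 =
    \sum_(i < w1) \sum_(j < w2)
      ((-1) ^+ (i + j) * q ^+ (w3 * (w2 * i + w1 * j))) *:
      trunc n (w1 * w2)%:R
        (fun m => (qEuler m (q ^+ (w1 * w2))).[x i j] / m`!%:R).
  (* [c] collects the factors of a term that do not depend on [i] and [j]. *)
  pose c : tser K n :=
    2%:R%:A * texp n ((w1 * w2 * w3)%:R * y) / (1 + u ^+ (w1 * w2)).
  transitivity (c * ((\sum_(i < w1) (- u ^+ (w2 * w3)) ^+ i) *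
                     (\sum_(j < w2) (- u ^+ (w3 * w1)) ^+ j))).
    rewrite !geom_sum_odd ?unit_uX // -!exprM.
    (* Both numerators become [1 + u^(w1 w2 w3)], which gives the square. *)
    rewrite [(w2 * w3 * w1)%N]mulnC [(w3 * w1 * w2)%N]mulnC.
    rewrite [(w2 * (w3 * w1))%N]mulnCA [(w3 * (w2 * w1))%N]mulnC.
    rewrite [(w2 * w1)%N]mulnC mulnA /c /euler_sum_series; ring.
  rewrite mulr_suml mulr_sumr; apply: eq_bigr => i _.
  rewrite mulr_sumr mulr_sumr; apply: eq_bigr => j _.
  rewrite trunc_qEuler // -uX.
  (* Substituting [t -> w1 w2 t] clears the denominators [w1] and [w2] of [x i j]. *)
  have -> : (w1 * w2)%:R * x i j =
      (w1 * w2 * w3)%:R * y + (w2 * w3 * i)%:R + (w3 * w1 * j)%:R.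
    by rewrite /x !natrM; field; rewrite !nz.
  rewrite !texpD // !(exprNn (u ^+ _)) -!exprM !uX.
  have -> : (w3 * (w2 * i + w1 * j) = w2 * w3 * i + w3 * w1 * j)%N.
    by rewrite mulnDr !mulnA [(w3 * w2)%N]mulnC.
  by rewrite (exprD q) -scale_signed_terms /c uX.
(* The coefficient of [t^n] in each truncation is [(w1 w2)^n] times [E_n / n!], which restores the
   prefactor. *)
rewrite /euler_double_sum mulr_sumr raddf_sum /= coef_sum mulr_sumr.
apply: eq_bigr => i _.
rewrite mulr_sumr raddf_sum /= coef_sum mulr_sumr; apply: eq_bigr => j _.
rewrite coefZ coef_trunc //; field; exact: natr_fact_neq0.
Qed.

(** Rotation fixes the product [w1 w2 w3] and permutes the three denominators cyclically. *)
Lemma euler_sum_series_rot w1 w2 w3 :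
  euler_sum_series w1 w2 w3 = euler_sum_series w2 w3 w1.
Proof.
rewrite /euler_sum_series [(w2 * w3 * w1)%N]mulnC [(w1 * (w2 * w3))%N]mulnA.
by congr (_ * _); rewrite [RHS]mulrC mulrA.
Qed.

Lemma euler_double_sum_rot w1 w2 w3 : odd w1 -> odd w2 -> odd w3 ->
  euler_double_sum q y n w1 w2 w3 = euler_double_sum q y n w2 w3 w1.
Proof.
by move=> odd1 odd2 odd3; rewrite !euler_double_sumE // euler_sum_series_rot.
Qed.

End Symmetry.

(** * Ultrametric bounds on powers of [q] *)

Section AbsoluteValue.
Variables (R : realType) (K : fieldType) (abs : K -> R).
Hypothesis habs : is_absval abs.

Lemma absval1 : abs 1 = 1.
Proof.
apply: (@mulfI _ (abs 1)); first by rewrite (absval_eq0 habs) oner_eq0.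
by rewrite -(absvalM habs) !mulr1.
Qed.

Lemma absvalN x : abs (- x) = abs x.
Proof.
have absN1 : abs (-1) = 1.
  apply/eqP; rewrite -(@eqrXn2 _ 2) ?ler01 ?(absval_ge0 habs) //.
  by rewrite expr1n expr2 -(absvalM habs) mulrNN mulr1 absval1.
by rewrite -mulN1r (absvalM habs) absN1 mul1r.
Qed.

(** Induction through [q^(k+1) - 1 = q (q^k - 1) + (q - 1)], with [|q| <= 1]. *)
Lemma absvalX_sub1_lt1 q k : abs (q - 1) < 1 -> abs (q ^+ k - 1) < 1.
Proof.
move=> hq; have q_le1 : abs q <= 1.
  rewrite -[q](subrK 1); apply: le_trans (absval_ultra habs _ _) _.
  by rewrite ge_max absval1 lexx ltW.
elim: k => [|k IHk].
  rewrite expr0 subrr.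
  by have /eqP -> : abs 0 == 0 by rewrite (absval_eq0 habs).
have -> : q ^+ k.+1 - 1 = q * (q ^+ k - 1) + (q - 1) by rewrite exprS; ring.
apply: le_lt_trans (absval_ultra habs _ _) _.
rewrite gt_max hq andbT (absvalM habs).
by apply: le_lt_trans IHk; rewrite ler_piMl // (absval_ge0 habs).
Qed.

(** If [q^k = -1], then [|q^k - 1| = |2| = 1], although it must be below 1. *)
Lemma expr_add1_neq0 q k : abs 2 = 1 -> abs (q - 1) < 1 -> q ^+ k + 1 != 0.
Proof.
move=> abs2 hq; apply/negP => /eqP qk.
have := absvalX_sub1_lt1 k hq.
have -> : q ^+ k - 1 = - 2 by rewrite -[q ^+ k](addrK 1) qk; ring.
by rewrite absvalN abs2 ltxx.
Qed.

End AbsoluteValue.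

(** * Characteristic, absolute value of 2 and radius in [C_p] *)

Section Cp.
Variables (R : realType) (p : nat) (T : Cp_tower R p).

Lemma absCp_rat (x : rat) :
  absCp T (Qp_to_Cp (rat_to_Qp T x)) = padic_abs R p x.
Proof.
rewrite (completion_isometry (Cp_completion T)) Qpbar_extends.
by rewrite (completion_isometry (Qp_completion T)).
Qed.

Lemma pchar_Cp : [pchar Cp T] =i pred0.
Proof.
apply/pcharf0P => m.
rewrite -(rmorph_nat (Qpbar_to_Cp T)) fmorph_eq0.
rewrite -(rmorph_nat (Qp_to_Qpbar T)) fmorph_eq0.
by rewrite -(rmorph_nat (rat_to_Qp T)) fmorph_eq0 pnatr_eq0.
Qed.

Lemma absCp2 : odd p -> absCp T 2 = 1.
Proof.
move=> odd_p.
have -> : 2 = Qp_to_Cp (rat_to_Qp T 2) by rewrite /Qp_to_Cp !rmorph_nat.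
rewrite absCp_rat /padic_abs.
have -> : numq 2 = 2 by [].
have -> : denq 2 = 1 by [].
rewrite logn1 lognE /=.
(* A prime [p] dividing 2 would be 2, against [odd p]; otherwise the valuation of 2 is 0. *)
case: ifP => [/andP[pr_p p2]|_]; last by rewrite expr0 divr1.
move: p2; rewrite dvdn_prime2 // => /eqP p2.
by rewrite p2 in odd_p.
Qed.

(** Weakens the bound on [q] to [|q - 1| < 1], the form taken by [expr_add1_neq0]. At [p = 1] the
    exponent is 0, by the convention that the inverse of 0 is 0. *)
Lemma radius_le1 : (0 < p)%N -> p%:R `^ (- (1 / (p%:R - 1))) <= 1 :> R.
Proof.
move=> p_gt0; rewrite powRN invf_le1 ?powR_gt0 ?ltr0n //.
have p_ge1 : 1 <= p%:R :> R by rewrite ler1n.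
by rewrite -[leLHS](powRr0 p%:R) ler_powR // div1r invr_ge0 subr_ge0.
Qed.

End Cp.

Unset Implicit Arguments.

Theorem theorem4p14 (R : realType) (p : nat) (p_prime : prime p)
    (p_odd : odd p) (T : Cp_tower R p) (q : Cp T)
    (hq : absCp T (q - 1) < p%:R `^ (- (1 / (p%:R - 1))))
    (w1 w2 w3 : nat) (w1_odd : odd w1) (w2_odd : odd w2) (w3_odd : odd w3)
    (n : nat) (y1 : Qp T) (hy1 : y1 \in @padic_int R p T) :
  let y : Cp T := Qp_to_Cp y1 in
  let S12 : Cp T :=
    (w1 * w2)%:R ^+ n *
    \sum_(i < w1) \sum_(j < w2)
      (-1) ^+ (i + j) * q ^+ (w3 * (w2 * i + w1 * j)) *
      (qEuler n (q ^+ (w1 * w2))).[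
        w3%:R * y + w3%:R / w1%:R * i%:R + w3%:R / w2%:R * j%:R] in
  let S23 : Cp T :=
    (w2 * w3)%:R ^+ n *
    \sum_(i < w2) \sum_(j < w3)
      (-1) ^+ (i + j) * q ^+ (w1 * (w3 * i + w2 * j)) *
      (qEuler n (q ^+ (w2 * w3))).[
        w1%:R * y + w1%:R / w2%:R * i%:R + w1%:R / w3%:R * j%:R] in
  let S31 : Cp T :=
    (w3 * w1)%:R ^+ n *
    \sum_(i < w3) \sum_(j < w1)
      (-1) ^+ (i + j) * q ^+ (w2 * (w1 * i + w3 * j)) *
      (qEuler n (q ^+ (w1 * w3))).[
        w2%:R * y + w2%:R / w3%:R * i%:R + w2%:R / w1%:R * j%:R] in
  S12 = S23 /\ S23 = S31.
Proof.
have hq1 : absCp T (q - 1) < 1.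
  by apply: lt_le_trans hq _; rewrite radius_le1 // prime_gt0.
have q_neqN1 k : q ^+ k + 1 != 0.
  apply: (expr_add1_neq0 (completion_absval (Cp_completion T))) => //.
  exact: absCp2.
have rot := euler_double_sum_rot (Qp_to_Cp y1) n (pchar_Cp T) q_neqN1.
move=> y S12 S23 S31; split; first exact: rot.
(* The third sum is stated with [q^(w1 w3)], whereas the rotation yields [q^(w3 w1)]. *)
by rewrite /S31 (mulnC w1 w3); apply: rot.
Qed.
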